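(* Let $n\ge 3$ and let $\mathbf{c}_0\in\mathbb{N}^n$ be an initial configuration on the directed cycle $C_n$ with $|\mathbf{c}_0|=n-1$. Then $\mathcal{A}(C_n,\mathbf{c}_0)\simeq S^{n-2}$.
   Context: $\mathbb{N}$ includes $0$. $C_n$ is the directed cycle with vertices $v_1,\dots,v_n$ and edges $(v_i,v_{i+1})$, indices modulo $n$; every vertex has out-degree $1$ and there are no sinks. A configuration is a vector $\mathbf{c}\in\mathbb{N}^n$, where $\mathbf{c}(v_i)$ is the number of grains on $v_i$; $|\mathbf{c}|$ is the sum of its entries. Parallel-firing sandpile dynamics started from $\mathbf{c}_0$: at each time $t=0,1,2,\dots$ the firing set $\sigma_t$ is the set of vertices $v_i$ with $\mathbf{c}_t(v_i)\ge 1$; all of these fire simultaneously, each sending one grain to its out-neighbour, so that $\mathbf{c}_{t+1}(v_i)=\mathbf{c}_t(v_i)-[v_i\in\sigma_t]+[v_{i-1}\in\sigma_t]$ (where $[\cdot]$ is $1$ if the condition holds and $0$ otherwise). The avalanche complex $\mathcal{A}(C_n,\mathbf{c}_0)$ is the simplicial complex generated by the firing sets, i.e. the simplices are all nonempty subsets of the sets $\sigma_t$, $t\ge 0$ (vertices that never fire are not vertices of the complex). $\simeq$ denotes homotopy equivalence. *)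

(* Defs.v *)
From HB Require Import structures.
From mathcomp Require Import all_boot all_order all_algebra.
From mathcomp Require Import all_classical all_reals all_analysis.

Set Implicit Arguments.
Unset Strict Implicit.
Unset Printing Implicit Defensive.

Import Order.TTheory GRing.Theory Num.Theory.
Import numFieldNormedType.Exports.

Local Open Scope classical_set_scope.
Local Open Scope ring_scope.

Record simplicial_complex (V : finType) := SimplicialComplex {
  simplex :> {set V} -> Prop;
  simplex_neq0 : forall s, simplex s -> s != finset.set0;
  simplex_subset : forall s t : {set V},
    t != finset.set0 -> t \subset s -> simplex s -> simplex t }.

Definition generated_simplex (V : finType) (F : set {set V}) (s : {set V}) :=
  s != finset.set0 /\ exists2 t, F t & s \subset t.

Lemma generated_simplex_neq0 (V : finType) (F : set {set V}) (s : {set V}) :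
  generated_simplex F s -> s != finset.set0.
Proof. by case. Qed.

Lemma generated_simplex_subset (V : finType) (F : set {set V})
    (s t : {set V}) :
  t != finset.set0 -> t \subset s ->
  generated_simplex F s -> generated_simplex F t.
Proof.
move=> t0 ts [_ [u Fu su]]; split=> //.
by exists u => //; apply: fintype.subset_trans su.
Qed.

Definition generated_complex (V : finType) (F : set {set V}) :=
  SimplicialComplex (@generated_simplex_neq0 V F)
    (@generated_simplex_subset V F).

(* Barycentric coordinates; points have coordinate 0 at each i : 'I_n that is
   not a vertex of K. *)
Definition realization (R : realType) (n : nat)
    (K : simplicial_complex 'I_n) : set 'rV[R]_n :=
  [set x | [/\ forall i, 0 <= x ord0 i,
               \sum_i x ord0 i = 1 &
               K [set i | x ord0 i != 0]%SET]].
Arguments realization R {n} K.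

Definition sphere (R : realType) (d : nat) : set 'rV[R]_d.+1 :=
  [set x | \sum_i x ord0 i ^+ 2 = 1].
Arguments sphere : clear implicits.

(* H is defined on all of X * R, but its values off X * [0, 1] are arbitrary and
   unconstrained. *)
Definition homotopic (R : realType) (X Y : topologicalType) (f g : X -> Y) :=
  exists H : X * R -> Y,
    [/\ {within [set: X] `*` `[0, 1], continuous H},
        forall x, H (x, 0) = f x & forall x, H (x, 1) = g x].

Definition homotopy_equivalent (R : realType) (X Y : topologicalType) :=
  exists (f : X -> Y) (g : Y -> X),
    [/\ continuous f, continuous g,
        homotopic R (g \o f) idfun & homotopic R (f \o g) idfun].

Section Sandpile.
Local Open Scope nat_scope.

(* The vertex v_i of the directed cycle is i : 'I_n, with in-neighbour
   ord_pred i, the cyclic predecessor of i. *)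
Definition config (n : nat) := {ffun 'I_n -> nat}.

Definition grains (n : nat) (c : config n) : nat := \sum_i c i.

Definition firing_set (n : nat) (c : config n) : {set 'I_n} :=
  [set i | 1 <= c i]%SET.

(* The truncated subtraction is exact: i \in firing_set c implies 1 <= c i. *)
Definition fire (n : nat) (c : config n) : config n :=
  [ffun i => c i - (i \in firing_set c) + (ord_pred i \in firing_set c)].

Definition config_at (n : nat) (c0 : config n) (t : nat) : config n :=
  iter t (@fire n) c0.

Definition avalanche_complex (n : nat) (c0 : config n) :
    simplicial_complex 'I_n :=
  generated_complex (range (fun t => firing_set (config_at c0 t))).

End Sandpile.

(* Main.v *)
Require Import Defs.
From mathcomp Require Import all_boot all_order all_algebra.
From mathcomp Require Import all_classical all_reals all_analysis.
Import numFieldNormedType.Exports.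

(** The avalanche complex is the boundary of the full simplex on the [n]
    vertices of the cycle, and that boundary is homeomorphic to the sphere.

    Dynamics. Follow the empty vertices rather than the grains. A vertex can be
    empty after a step only if its predecessor was empty before it, so the set
    of empty vertices moves one step along the cycle and possibly loses
    elements: an empty place is filled when it reaches a vertex carrying at
    least two grains ([empty_vertices_fire]). Consider a time at which the
    number of empty vertices is minimal. From then on no empty place is lost,
    and since each of them visits the whole cycle, no vertex can carry two
    grains ([config_le1]). With [n - 1] grains there is then exactly one empty
    vertex, and it travels around the cycle
    ([eventually_one_empty_vertex]). Hence the complement of every vertex is a
    firing set; the whole vertex set never is, as it would need [n] grains and
    the number of grains is preserved ([avalanche_complexE]).

    Topology. A point of the boundary of the simplex is a nonnegative vector
    with sum [1] and minimum [0]. Each ray issuing from the barycenter meets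
    this boundary exactly once. In algebraic terms, such rays are the classes of
    nonconstant vectors modulo adding a constant to all coordinates and scaling
    by a positive number. The differences with coordinate [0] kill the additive
    constant, and normalizing them for the Euclidean norm lands in the sphere
    ([to_sphere]).
    Conversely, subtracting the minimum from all coordinates and dividing by
    the sum picks the representative of a direction that lies on the boundary
    ([to_boundary]). These continuous maps are inverse to each other, so the
    homotopies can be taken constant. *)

Set Implicit Arguments.
Unset Strict Implicit.
Unset Printing Implicit Defensive.

Import Order.TTheory GRing.Theory Num.Theory.

(** * Firing on the directed cycle *)

Section CycleDynamics.
Local Open Scope nat_scope.
Variable n : nat.
Implicit Types (c : config n) (i j : 'I_n).

Definition empty_vertices c : {set 'I_n} := [set i | c i == 0]%SET.

Lemma firing_setE c : firing_set c = (~: empty_vertices c)%SET.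
Proof. by apply/setP => i; rewrite !inE lt0n. Qed.

Lemma fireE c i : fire c i = c i - (0 < c i) + (0 < c (ord_pred i)).
Proof. by rewrite ffunE !inE. Qed.

Lemma grains_fire c : grains (fire c) = grains c.
Proof.
rewrite /grains (eq_bigr _ (fun i _ => fireE c i)) big_split /=.
rewrite -(reindex_inj (@ord_pred_inj n) (P := predT)
  (F := fun i => (0 < c i) : nat)).
rewrite -big_split; apply: eq_bigr => i _ /=.
by case: (c i) => //= k; rewrite subn1 addn1.
Qed.

Lemma grains_config_at c t : grains (config_at c t) = grains c.
Proof. by elim: t => //= t <-; exact: grains_fire. Qed.

(** A vertex whose predecessor fires receives a grain. *)
Lemma empty_vertices_fire c :
  empty_vertices (fire c) \subset @ordS n @: empty_vertices c.
Proof.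
apply/fintype.subsetP => i; rewrite inE fireE addn_eq0 => /andP[_].
rewrite eqb0 -eqn0Ngt => ci; apply/imsetP; exists (ord_pred i).
  by rewrite inE.
by rewrite ord_predK.
Qed.

Lemma card_empty_vertices_fire c :
  #|empty_vertices (fire c)| <= #|empty_vertices c|.
Proof.
apply: leq_trans (subset_leq_card (empty_vertices_fire c)) _.
exact: leq_imset_card.
Qed.

Lemma empty_vertices_fire_eq c :
  #|empty_vertices c| <= #|empty_vertices (fire c)| ->
  empty_vertices (fire c) = (@ordS n @: empty_vertices c)%SET.
Proof.
move=> le_c; apply/eqP; rewrite eqEcard empty_vertices_fire.
by apply: leq_trans le_c; exact: leq_imset_card.
Qed.

Lemma empty_vertices_neq0 c : grains c < n -> empty_vertices c != finset.set0.
Proof.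
apply: contraTneq => c0.
rewrite -leqNgt /grains -[leqLHS](card_ord n) -sum1_card.
apply: leq_sum => i _; rewrite lt0n; apply/negP => ci.
by have := finset.in_set0 i; rewrite -c0 inE ci.
Qed.

Lemma iter_ordS i k : iter k (@ordS n) i = (i + k) %% n :> nat.
Proof.
elim: k => [|k IHk] /=; first by rewrite addn0 modn_small.
by rewrite IHk addnS -addn1 modnDml addn1.
Qed.

Lemma iter_ordS_trans i j : exists k, iter k (@ordS n) i = j.
Proof.
exists (j + n - i); apply: val_inj; rewrite /= iter_ordS subnKC.
  by rewrite modnDr modn_small.
by rewrite (leq_trans (ltnW (ltn_ord i)))// leq_addl.
Qed.

Lemma config_atD c s t : config_at c (s + t) = config_at (config_at c s) t.
Proof. by rewrite /config_at addnC iterD. Qed.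

(** From a time of minimum on, no empty place is ever lost. *)
Lemma ex_min_empty_vertices c : exists t, forall s,
  #|empty_vertices (config_at c t)| <= #|empty_vertices (config_at c s)|.
Proof.
(* Classical truth value: whether [k] is attained is a question about all
   times. *)
pose P k := `[< exists t, #|empty_vertices (config_at c t)| = k >].
have exP : exists k, P k by exists #|empty_vertices c|; apply/asboolP; exists 0.
case: (ex_minnP exP) => k /asboolP[t <-] mint.
by exists t => s; apply: mint; apply/asboolP; exists s.
Qed.

Section ConstantNumberOfEmptyVertices.
Variable c : config n.
Hypothesis minc : forall t,
  #|empty_vertices c| <= #|empty_vertices (config_at c t)|.

Lemma card_empty_vertices_at t :
  #|empty_vertices (config_at c t)| = #|empty_vertices c|.
Proof.
apply/eqP; rewrite eqn_leq minc andbT.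
by elim: t => //= t; apply: leq_trans; exact: card_empty_vertices_fire.
Qed.

Lemma empty_vertices_at_succ t : empty_vertices (config_at c t.+1) =
  (@ordS n @: empty_vertices (config_at c t))%SET.
Proof.
apply: empty_vertices_fire_eq; rewrite card_empty_vertices_at.
exact: minc t.+1.
Qed.

Lemma empty_vertices_at_iter t i : i \in empty_vertices c ->
  iter t (@ordS n) i \in empty_vertices (config_at c t).
Proof.
move=> ci; elim: t => //= t IHt.
by rewrite empty_vertices_at_succ; exact: imset_f.
Qed.

(** An empty place is filled when it moves onto a vertex with two grains or
    more. Here no empty place is ever lost, so such a vertex never has an empty
    predecessor and therefore keeps its grains; but the empty place at [j]
    reaches every vertex, the predecessor of [i] included. *)
Lemma config_le1 i : empty_vertices c != finset.set0 -> c i <= 1.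
Proof.
move=> /set0Pn[j cj]; rewrite leqNgt; apply/negP => ci.
have stay t : 1 < config_at c t i /\
              ord_pred i \notin empty_vertices (config_at c t).
  have predF s : 1 < config_at c s i ->
      ord_pred i \notin empty_vertices (config_at c s).
    move=> cs; apply/negP => /(imset_f (@ordS n)).
    rewrite -empty_vertices_at_succ ord_predK inE /= fireE addn_eq0 => /andP[].
    by move: cs; case: (config_at c s i) => [|[]].
  elim: t => [|t [IHt predt]]; first by split=> //; exact: predF.
  suff ct : 1 < config_at c t.+1 i by split=> //; exact: predF.
  rewrite /= fireE; move: predt; rewrite inE -lt0n => ->.
  by move: IHt; case: (config_at c t i) => [|k] //; rewrite subn1 addn1.
have [k jk] := iter_ordS_trans j (ord_pred i).
by have [_] := stay k; rewrite -jk empty_vertices_at_iter.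
Qed.

End ConstantNumberOfEmptyVertices.

(** Once every vertex carries at most one grain, the grains and the empty
    vertices together number [n], which leaves one empty vertex. *)
Lemma eventually_one_empty_vertex c : 0 < n -> grains c = n - 1 ->
  exists t i, forall s,
    empty_vertices (config_at c (t + s)) = [set iter s (@ordS n) i]%SET.
Proof.
move=> n0 cn; have [t tmin] := ex_min_empty_vertices c.
set b := config_at c t.
have bmin s : #|empty_vertices b| <= #|empty_vertices (config_at b s)|.
  by rewrite -config_atD; exact: tmin.
have bn : grains b = n - 1 by rewrite grains_config_at.
have b0 : empty_vertices b != finset.set0.
  by apply: empty_vertices_neq0; rewrite bn subn1 ltn_predL.
have card_b : #|empty_vertices b| = 1.
  have : grains b + #|empty_vertices b| = n.
    rewrite -[RHS]card_ord /grains -sum1_card [X in _ + X]big_mkcond -big_split.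
    rewrite -sum1_card; apply: eq_bigr => i _ /=; rewrite inE.
    by move: (config_le1 bmin i b0); case: (b i) => [|[]].
  by move=> bE; apply: (@addnI (n - 1)); rewrite subnK// -bn.
have /eqP/cards1P[i bi] := card_b.
exists t, i => s; apply/esym/eqP; rewrite config_atD -/b eqEcard.
rewrite (card_empty_vertices_at bmin) card_b cards1 leqnn andbT finset.sub1set.
by apply: empty_vertices_at_iter => //; rewrite bi inE.
Qed.

(** The simplices are those of the boundary of the full simplex: a proper
    subset misses a vertex [j], and all its vertices fire at a time when [j] is
    the only empty vertex. *)
Lemma avalanche_complexE c (s : {set 'I_n}) : 0 < n -> grains c = n - 1 ->
  avalanche_complex c s <-> s != finset.set0 /\ s != [set: 'I_n]%SET.
Proof.
move=> n0 cn; split=> -[s0]; last first.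
  rewrite -finset.setC0 -(inj_eq (@finset.setC_inj _)) finset.setCK.
  move=> /set0Pn[j].
  rewrite inE => js.
  have [t [i H]] := eventually_one_empty_vertex n0 cn.
  have [k ik] := iter_ordS_trans i j.
  split=> //; exists (firing_set (config_at c (t + k))).
    by exists (t + k).
  by rewrite firing_setE H ik finset.subsetC finset.sub1set finset.in_setC.
move=> [_ [t _ <-] st]; split=> //; apply: contraL st => /eqP ->.
rewrite firing_setE finset.subTset.
apply: contraNneq (_ : empty_vertices (config_at c t) != finset.set0).
  by move=> /(congr1 (@finset.setC _)); rewrite finset.setCK finset.setCT => ->.
by apply: empty_vertices_neq0; rewrite grains_config_at cn subn1 ltn_predL.
Qed.

End CycleDynamics.

(** * Continuity and homotopy equivalence of subsets *)

Section ContinuousMaps.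
Local Open Scope classical_set_scope.
Local Open Scope ring_scope.

Lemma homotopic_eq (R : realType) (X Y : topologicalType) (f g : X -> Y) :
  continuous f -> f =1 g -> homotopic R f g.
Proof.
move=> cf fg; exists (f \o fst); split=> //.
apply: continuous_subspaceT => p.
apply: (@continuous_comp _ _ _ fst f).
  exact: cvg_fst.
exact: cf.
Qed.

(** The maps are only required to be continuous at the points of the subsets,
    because normalizing a vector is discontinuous at [0]. *)
Lemma homotopy_equivalent_subsets (R : realType) (X Y : topologicalType)
    (A : set X) (B : set Y) (f : X -> Y) (g : Y -> X) :
  (forall x, A x -> B (f x)) -> (forall y, B y -> A (g y)) ->
  (forall x, A x -> {for x, continuous f}) ->
  (forall y, B y -> {for y, continuous g}) ->
  (forall x, A x -> g (f x) = x) -> (forall y, B y -> f (g y) = y) ->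
  homotopy_equivalent R (set_type A) (set_type B).
Proof.
move=> fAB gBA fcont gcont fK gK.
pose f' (a : set_type A) : set_type B := SigSub (mem_set (fAB _ (set_valP a))).
pose g' (b : set_type B) : set_type A := SigSub (mem_set (gBA _ (set_valP b))).
have f'cont : continuous f'.
  apply: continuous_comp_initial => a.
  apply: (@continuous_comp _ _ _ set_val f); first exact: initial_continuous.
  exact: fcont (set_valP a).
have g'cont : continuous g'.
  apply: continuous_comp_initial => b.
  apply: (@continuous_comp _ _ _ set_val g); first exact: initial_continuous.
  exact: gcont (set_valP b).
have f'K a : g' (f' a) = a by apply: val_inj => /=; exact: fK (set_valP a).
have g'K b : f' (g' b) = b by apply: val_inj => /=; exact: gK (set_valP b).
exists f', g'; split=> //; apply: homotopic_eq => // x; apply: continuous_comp.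
- exact: f'cont.
- exact: g'cont.
- exact: g'cont.
- exact: f'cont.
Qed.

Lemma continuous_mx (X T : topologicalType) (m n : nat)
    (F : 'I_m -> 'I_n -> X -> T) (x : X) :
  (forall i j, {for x, continuous (F i j)}) ->
  {for x, continuous (fun y => \matrix_(i, j) F i j y)}.
Proof.
move=> Fcont U [P FP PU]; apply: (filterS (fun y => PU (\matrix_(i, j) F i j y))).
have FPnear i j : \forall y \near x, P i j (F i j y).
  by have := FP i j; rewrite mxE => /Fcont.
have : \forall y \near x, forall i j, P i j (F i j y).
  apply: (@filter_forall X 'I_m (fun i y => forall j, P i j (F i j y))) => i.
  exact: (@filter_forall X 'I_n (fun j y => P i j (F i j y)) _ _ (FPnear i)).
by apply: filterS => y Py i j; rewrite mxE.
Qed.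

Lemma continuous_sum (R : realType) (X : topologicalType) (I : Type) (r : seq I)
    (F : I -> X -> R) (x : X) :
  (forall i, {for x, continuous (F i)}) ->
  {for x, continuous (fun y => \sum_(i <- r) F i y)}.
Proof.
by move=> Fc; apply: cvg_big => [|i _]; [exact: add_continuous | exact: Fc].
Qed.

End ContinuousMaps.

(** * The boundary of a simplex and the sphere *)

Section BoundaryOfSimplex.
Local Open Scope classical_set_scope.
Local Open Scope ring_scope.
Variables (R : realType) (d : nat).
Implicit Types (x y : 'rV[R]_d.+2) (u : 'rV[R]_d.+1).

Definition simplex_boundary : set 'rV[R]_d.+2 :=
  [set x | [/\ forall i, 0 <= x ord0 i, \sum_i x ord0 i = 1 &
               exists i, x ord0 i = 0]].

Definition norm2 u : R := Num.sqrt (\sum_i u ord0 i ^+ 2).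

Definition differences x : 'rV[R]_d.+1 :=
  \row_i (x ord0 (lift ord0 i) - x ord0 ord0).

Definition to_sphere x := (norm2 (differences x))^-1 *: differences x.

Definition extend0 u : 'rV[R]_d.+2 :=
  \row_i oapp (fun j => u ord0 j) 0 (unlift ord0 i).

Definition min_entry y : R :=
  \big[Num.min/y ord0 ord0]_i y ord0 i.

(** The vectors whose [differences] are [u] differ from each other by constant
    vectors; this is the one with minimum [0]. *)
Definition heights u : 'rV[R]_d.+2 :=
  \row_i (extend0 u ord0 i - min_entry (extend0 u)).

Definition to_boundary u :=
  (\sum_i heights u ord0 i)^-1 *: heights u.

Lemma extend0_ord0 u : extend0 u ord0 ord0 = 0.
Proof. by rewrite mxE unlift_none. Qed.

Lemma extend0_lift u i : extend0 u ord0 (lift ord0 i) = u ord0 i.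
Proof. by rewrite mxE liftK. Qed.

Lemma min_entry_le y i : min_entry y <= y ord0 i.
Proof. exact: bigmin_le_cond. Qed.

Lemma min_entry_attained y : exists i, min_entry y = y ord0 i.
Proof.
rewrite /min_entry; elim/big_ind: _ => [|a b [i ->] [j ->]|i _].
- by exists ord0.
- by case: leP => _; [exists i|exists j].
- by exists i.
Qed.

Lemma min_entryE y a :
  (forall i, a <= y ord0 i) -> (exists i, y ord0 i = a) -> min_entry y = a.
Proof.
move=> ay [i yi]; apply/eqP; rewrite eq_le -{1}yi min_entry_le /=.
by have [j ->] := min_entry_attained y.
Qed.

Lemma norm2_gt0 u : u != 0 -> 0 < norm2 u.
Proof.
move=> /rV0Pn[i ui]; rewrite sqrtr_gt0 (bigD1 i)//=.
by rewrite ltr_wpDr ?exprn_even_gt0 ?sumr_ge0// => j _; exact: sqr_ge0.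
Qed.

Lemma norm2Z a u : 0 <= a -> norm2 (a *: u) = a * norm2 u.
Proof.
move=> a0; rewrite /norm2 (eq_bigr (fun i => a ^+ 2 * u ord0 i ^+ 2)) => [|i _].
  by rewrite -mulr_sumr sqrtrM ?sqr_ge0// sqrtr_sqr ger0_norm.
by rewrite mxE exprMn.
Qed.

Lemma sphereE u : sphere R d u <-> norm2 u = 1.
Proof.
rewrite /sphere /norm2 /=; split=> [->|u1]; first exact: sqrtr1.
by rewrite -[LHS]sqr_sqrtr ?u1 ?expr1n// sumr_ge0// => i _; exact: sqr_ge0.
Qed.

Lemma heights_ge0 u i : 0 <= heights u ord0 i.
Proof. by rewrite mxE subr_ge0 min_entry_le. Qed.

(** [differences] ignores the constant that [heights] subtracts. *)
Lemma differences_heights u : differences (heights u) = u.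
Proof.
apply/rowP => i; rewrite !mxE opprB addrA subrK liftK unlift_none /=.
by rewrite subr0.
Qed.

Lemma differencesZ a x : differences (a *: x) = a *: differences x.
Proof. by apply/rowP => i; rewrite !mxE mulrBr. Qed.

(** As coordinate [0] of [x] has been subtracted from the others, the minimum
    of the extended vector is [- (a * x ord0 ord0)]: the constant to be
    subtracted is the one that was removed. *)
Lemma heights_differences x a : 0 <= a -> (forall i, 0 <= x ord0 i) ->
  (exists i, x ord0 i = 0) -> heights (a *: differences x) = a *: x.
Proof.
move=> a0 x0 [k xk].
have extE i : extend0 (a *: differences x) ord0 i = a * (x ord0 i - x ord0 ord0).
  have [j ->|->] := unliftP ord0 i; first by rewrite extend0_lift !mxE.
  by rewrite extend0_ord0 subrr mulr0.
apply/rowP => i; rewrite [LHS]mxE [RHS]mxE extE.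
rewrite (@min_entryE _ (- (a * x ord0 ord0))) ?opprK ?mulrBr ?subrK//.
  by move=> j; rewrite extE mulrBr lerDr mulr_ge0.
by exists k; rewrite extE xk sub0r mulrN.
Qed.

(** Nonnegative heights with sum [0] all vanish, and then so do their
    differences, which are the entries of [u]. *)
Lemma sum_heights_gt0 u : u != 0 -> 0 < \sum_i heights u ord0 i.
Proof.
move=> u0; rewrite lt_neqAle eq_sym sumr_ge0 ?andbT => [|i _]; last first.
  exact: heights_ge0.
apply: contra u0; rewrite psumr_eq0 => [/allP h0|i _]; last exact: heights_ge0.
rewrite -(differences_heights u); apply/eqP/rowP => i.
have hz j : heights u ord0 j = 0 by apply/eqP/(implyP (h0 j (mem_index_enum j))).
by rewrite mxE !hz subrr mxE.
Qed.

(** The barycenter, whose coordinates are all equal, is not on the boundary: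
    a constant vector with a zero entry does not have sum [1]. *)
Lemma differences_neq0 x : simplex_boundary x -> differences x != 0.
Proof.
move=> [_ x1 [k xk]]; apply/eqP => dx0.
have xE i : x ord0 i = x ord0 ord0.
  have [j ->|->//] := unliftP ord0 i.
  by move/rowP/(_ j): dx0; rewrite !mxE => /eqP; rewrite subr_eq0 => /eqP.
move: x1; rewrite big1 => [/eqP|i _]; first by rewrite eq_sym oner_eq0.
by rewrite xE -(xE k).
Qed.

Lemma sphere_neq0 u : sphere R d u -> u != 0.
Proof.
move=> /= u1; apply: contra_eq_neq u1 => ->.
by rewrite big1 ?(eq_sym 0) ?oner_eq0// => i _; rewrite mxE expr0n.
Qed.

Lemma to_sphere_sphere x : simplex_boundary x -> sphere R d (to_sphere x).
Proof.
move=> /differences_neq0/norm2_gt0 dx; apply/sphereE.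
by rewrite norm2Z ?invr_ge0 ?ltW// mulVf// gt_eqF.
Qed.

Lemma to_boundary_boundary u : sphere R d u -> simplex_boundary (to_boundary u).
Proof.
move=> /sphere_neq0/sum_heights_gt0 s0; split=> [i||].
- by rewrite mxE mulr_ge0 ?heights_ge0// invr_ge0 ltW.
- under eq_bigr do rewrite mxE.
  by rewrite -mulr_sumr mulVf// gt_eqF.
- have [i ui] := min_entry_attained (extend0 u); exists i.
  by rewrite !mxE ui mxE subrr mulr0.
Qed.

Lemma to_sphereK x : simplex_boundary x -> to_boundary (to_sphere x) = x.
Proof.
move=> bx; have /norm2_gt0 dx := differences_neq0 bx.
case: bx => x0 x1 xk; rewrite /to_boundary heights_differences ?invr_ge0 ?ltW//.
under eq_bigr do rewrite mxE.
by rewrite -mulr_sumr x1 mulr1 scalerA invrK mulfV ?scale1r// gt_eqF.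
Qed.

Lemma to_boundaryK u : sphere R d u -> to_sphere (to_boundary u) = u.
Proof.
move=> su; have /sum_heights_gt0 s0 := sphere_neq0 su.
move/sphereE: su => su.
rewrite /to_sphere /to_boundary differencesZ differences_heights.
rewrite norm2Z ?invr_ge0 ?ltW// su mulr1 invrK scalerA mulfV ?scale1r//.
by rewrite gt_eqF.
Qed.

Lemma continuous_differences : continuous differences.
Proof.
move=> x; apply: continuous_mx => _ j.
by apply: continuousB; exact: coord_continuous.
Qed.

Lemma continuous_norm2 : continuous norm2.
Proof.
move=> u; apply: (@continuous_comp _ _ _ (fun u => \sum_i u ord0 i ^+ 2)).
  apply: continuous_sum => i.
  apply: (@continuous_comp _ _ _ (fun u => u ord0 i) (fun a => a ^+ 2)).
    exact: coord_continuous.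
  exact: exprn_continuous.
exact: sqrt_continuous.
Qed.

Lemma continuous_extend0 : continuous extend0.
Proof.
move=> u; apply: continuous_mx => _ j.
case: (unlift ord0 j) => [k|] /=; last exact: cst_continuous.
exact: coord_continuous.
Qed.

(** The first entry, which is the default value of the minimum, varies with [y];
    continuity follows by induction on the list of indices. *)
Lemma continuous_min_entry : continuous min_entry.
Proof.
move=> y; rewrite /continuous_at /min_entry; elim: (index_enum _) => [|i r IHr].
  rewrite big_nil; under eq_cvg do rewrite big_nil; exact: coord_continuous.
rewrite big_cons; under eq_cvg do rewrite big_cons.
by apply: continuous_min => //; exact: coord_continuous.
Qed.

Lemma continuous_heights : continuous heights.
Proof.
move=> u; apply: continuous_mx => _ j.
apply: continuousB.
  apply: (@continuous_comp _ _ _ extend0 (fun y => y ord0 j)).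
    exact: continuous_extend0.
  exact: coord_continuous.
apply: (@continuous_comp _ _ _ extend0 min_entry).
  exact: continuous_extend0.
exact: continuous_min_entry.
Qed.

Lemma continuous_to_sphere x :
  simplex_boundary x -> {for x, continuous to_sphere}.
Proof.
move=> /differences_neq0/norm2_gt0 dx.
apply: continuousZ; last exact: continuous_differences.
apply: continuousV; first by rewrite gt_eqF.
apply: (@continuous_comp _ _ _ differences norm2).
  exact: continuous_differences.
exact: continuous_norm2.
Qed.

Lemma continuous_to_boundary u :
  sphere R d u -> {for u, continuous to_boundary}.
Proof.
move=> /sphere_neq0/sum_heights_gt0 s0.
apply: continuousZ; last exact: continuous_heights.
apply: continuousV; first by rewrite gt_eqF.
apply: continuous_sum => i.
apply: (@continuous_comp _ _ _ heights (fun y => y ord0 i)).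
  exact: continuous_heights.
exact: coord_continuous.
Qed.

(** The support of a point is a proper subset exactly when some barycentric
    coordinate vanishes; it is nonempty since the coordinates have sum [1]. *)
Lemma realization_boundary (K : simplicial_complex 'I_d.+2) :
  (forall s : {set 'I_d.+2},
    K s <-> s != finset.set0 /\ s != [set: 'I_d.+2]%SET) ->
  realization R K = simplex_boundary.
Proof.
move=> KE; apply/seteqP; split=> x /= [x0 x1].
  move=> /KE[_].
  rewrite -finset.setC0 -(inj_eq (@finset.setC_inj _)) finset.setCK.
  by move=> /set0Pn[i]; rewrite !inE negbK => /eqP xi; split=> //; exists i.
move=> [i xi]; split=> //; apply/KE; split.
  apply/eqP => s0; move: x1; rewrite big1 => [/eqP|j _].
    by rewrite eq_sym oner_eq0.
  by apply/eqP/negPn; move/setP/(_ j): s0; rewrite !inE => ->.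
by apply/eqP => /setP/(_ i); rewrite !inE xi eqxx.
Qed.

Lemma boundary_homotopy_equivalent_sphere :
  homotopy_equivalent R (set_type simplex_boundary) (set_type (sphere R d)).
Proof.
apply: (@homotopy_equivalent_subsets _ _ _ _ _ to_sphere to_boundary).
- exact: to_sphere_sphere.
- exact: to_boundary_boundary.
- exact: continuous_to_sphere.
- exact: continuous_to_boundary.
- exact: to_sphereK.
- exact: to_boundaryK.
Qed.

End BoundaryOfSimplex.

(* set_type A is the set A with the subspace topology. *)
Theorem corollary3p22 (R : realType) (n : nat) (c0 : config n) :
  (3 <= n)%N -> grains c0 = (n - 1)%N ->
  homotopy_equivalent R
    (set_type (realization R (avalanche_complex c0)))
    (set_type (sphere R (n - 2)%N)).
Proof.
case: n c0 => [|[|d]] // c0 _ c0n.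
have -> : (d.+2 - 2 = d)%N by rewrite subn2.
rewrite (realization_boundary R (fun s => avalanche_complexE s isT c0n)).
exact: boundary_homotopy_equivalent_sphere.
Qed.
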